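(* Let $\mathbf{L}\in\mathbb{R}^{N\times N}$ be a symmetric matrix, and let the unknowns be partitioned into two non-overlapping sets $V_1$ (boundary set) and $V_2$ (interior set). For each $\mathbf{b}\in\mathbb{R}^N$, let $\mathbf{x}^{(n)}$ be the result of $n$ applications, starting from $\mathbf{x}^{(0)}=\mathbf{0}$, of the combined smoother for $\mathbf{L}\mathbf{x}=\mathbf{b}$ that performs successively (1) symmetric Vanka smoothing on $V_1$, (2) symmetric distributive smoothing on $V_2$, (3) the same symmetric Vanka smoothing on $V_1$ again. Then for every integer $n\ge 1$ there is a symmetric matrix $\mathbf{C}\in\mathbb{R}^{N\times N}$, independent of $\mathbf{b}$, such that $\mathbf{x}^{(n)}=\mathbf{C}\mathbf{b}$ for all $\mathbf{b}\in\mathbb{R}^N$.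
   Context: Order the unknowns so that $$\mathbf{L}=\begin{pmatrix}\mathbf{L}_{11}&\mathbf{L}_{12}\\ \mathbf{L}_{21}&\mathbf{L}_{22}\end{pmatrix},\quad \mathbf{x}=\begin{pmatrix}\mathbf{x}_1\\ \mathbf{x}_2\end{pmatrix},\quad \mathbf{b}=\begin{pmatrix}\mathbf{b}_1\\ \mathbf{b}_2\end{pmatrix},$$ where $\mathbf{x}_1,\mathbf{x}_2$ are the unknowns in $V_1,V_2$. Smoothing on $V_1$: with $\mathbf{x}_2$ held fixed, a fixed number $q\ge1$ of symmetric Vanka sweeps is applied to $\mathbf{L}_{11}\mathbf{x}_1=\mathbf{b}_1-\mathbf{L}_{12}\mathbf{x}_2$, starting from the current $\mathbf{x}_1$; steps (1) and (3) use the same type of sweep, the same subdomains and the same $q$. Smoothing on $V_2$: with $\mathbf{x}_1$ held fixed, a fixed number $r\ge1$ of symmetric distributive Gauss-Seidel sweeps is applied to $\mathbf{L}_{22}\mathbf{x}_2=\mathbf{b}_2-\mathbf{L}_{21}\mathbf{x}_1$, starting from the current $\mathbf{x}_2$. Sweeps, for a generic system $\mathbf{\Lambda}\mathbf{z}=\mathbf{g}$ (with $\mathbf{\Lambda}=\mathbf{L}_{11}$ or $\mathbf{L}_{22}$): Symmetric Vanka sweep. Let $\mathbf{C}_1,\dots,\mathbf{C}_m$ be selection matrices ($0/1$ matrices whose rows are standard basis row vectors indexed by the elements of a subset) onto potentially overlapping subdomains $D_1,\dots,D_m$ of the unknowns, with each $\mathbf{C}_i\mathbf{\Lambda}\mathbf{C}_i^T$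 invertible, and put $\mathbf{K}_i=\mathbf{C}_i^T(\mathbf{C}_i\mathbf{\Lambda}\mathbf{C}_i^T)^{-1}\mathbf{C}_i$. The sweep is either additive, $$\mathbf{z}\leftarrow\mathbf{z}+\Bigl(\sum_{i=1}^m\mathbf{K}_i\Bigr)(\mathbf{g}-\mathbf{\Lambda}\mathbf{z}),$$ or symmetric multiplicative (with $\mathbf{\Lambda}$ invertible), $$\mathbf{z}\leftarrow\mathbf{z}+\mathbf{S}^{(1)}(\mathbf{g}-\mathbf{\Lambda}\mathbf{z}),\quad\text{then}\quad \mathbf{z}\leftarrow\mathbf{z}+\mathbf{S}^{(2)}(\mathbf{g}-\mathbf{\Lambda}\mathbf{z}),$$ where $\mathbf{S}^{(1)}=[\mathbf{I}-(\mathbf{I}-\mathbf{K}_m\mathbf{\Lambda})\cdots(\mathbf{I}-\mathbf{K}_1\mathbf{\Lambda})]\mathbf{\Lambda}^{-1}$ and $\mathbf{S}^{(2)}=[\mathbf{I}-(\mathbf{I}-\mathbf{K}_1\mathbf{\Lambda})\cdots(\mathbf{I}-\mathbf{K}_m\mathbf{\Lambda})]\mathbf{\Lambda}^{-1}$. Symmetric distributive Gauss-Seidel sweep. Let $\mathbf{M}$ be a square matrix (the distribution matrix) of the same size as $\mathbf{\Lambda}$ and let $\mathbf{\tilde G}$ be the lower triangular part, including the diagonal, of $\mathbf{\Lambda}\mathbf{M}$, assumed invertible. The sweep is $$\mathbf{z}\leftarrow\mathbf{z}+\mathbf{M}\mathbf{\tilde G}^{-1}(\mathbf{g}-\mathbf{\Lambda}\mathbf{z}),\quad\text{then}\quad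 \mathbf{z}\leftarrow\mathbf{z}+\mathbf{\tilde G}^{-T}\mathbf{M}^T(\mathbf{g}-\mathbf{\Lambda}\mathbf{z}).$$ *)

(* Defs.v *)
From mathcomp Require Import all_boot all_order all_algebra.
From mathcomp Require Import reals.

Set Implicit Arguments.
Unset Strict Implicit.
Unset Printing Implicit Defensive.

Import GRing.Theory.

Local Open Scope ring_scope.

Section Sweeps.
Variables (R : realType) (n : nat).
Implicit Types (A M S : 'M[R]_n) (g z : 'cV[R]_n).

Definition correction A g S z : 'cV[R]_n := z + S *m (g - A *m z).

(* The rows are the standard basis vectors e_j for j in D, in increasing      *)
(* order; the subdomain correction vanka_mx A D below does not depend on the  *)
(* order of the rows.                                                         *)
Definition selection_mx (D : {set 'I_n}) : 'M[R]_(#|D|, n) :=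
  \matrix_(i < #|D|) delta_mx 0 (enum_val i).

Definition local_mx A (D : {set 'I_n}) : 'M[R]_#|D| :=
  selection_mx D *m A *m (selection_mx D)^T.

Definition vanka_mx A (D : {set 'I_n}) : 'M[R]_n :=
  (selection_mx D)^T *m invmx (local_mx A D) *m selection_mx D.

Definition additive_mx m (D : 'I_m -> {set 'I_n}) A : 'M[R]_n :=
  \sum_(i < m) vanka_mx A (D i).

(* \big[mulmx/1%:M]_(i < m) F i is F 0 *m F 1 *m ... *m F (m - 1), so the     *)
(* forward half-sweep, which visits D 0 first, has D 0 as rightmost factor.   *)
Definition forward_mx m (D : 'I_m -> {set 'I_n}) A : 'M[R]_n :=
  (1%:M - \big[mulmx/1%:M]_(i < m) (1%:M - vanka_mx A (D (rev_ord i)) *m A))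
    *m invmx A.

Definition backward_mx m (D : 'I_m -> {set 'I_n}) A : 'M[R]_n :=
  (1%:M - \big[mulmx/1%:M]_(i < m) (1%:M - vanka_mx A (D i) *m A))
    *m invmx A.

Inductive vanka_kind := Additive | Multiplicative.

Definition vanka_admissible (k : vanka_kind) m (D : 'I_m -> {set 'I_n}) A :
    Prop :=
  (forall i, local_mx A (D i) \in unitmx) /\
  (k = Multiplicative -> A \in unitmx).

Definition vanka_sweep (k : vanka_kind) m (D : 'I_m -> {set 'I_n}) A g z :
    'cV[R]_n :=
  match k with
  | Additive => correction A g (additive_mx D A) z
  | Multiplicative =>
      correction A g (backward_mx D A) (correction A g (forward_mx D A) z)
  end.

Definition lower_part A : 'M[R]_n :=
  \matrix_(i, j) (if (j <= i)%N then A i j else 0).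

Definition dgs_admissible M A : Prop := lower_part (A *m M) \in unitmx.

Definition dgs_sweep M A g z : 'cV[R]_n :=
  let G := lower_part (A *m M) in
  correction A g ((invmx G)^T *m M^T) (correction A g (M *m invmx G) z).

End Sweeps.

Section Smoother.
Variables (R : realType) (n1 n2 : nat) (L : 'M[R]_(n1 + n2)).
Implicit Types b x : 'cV[R]_(n1 + n2).

Definition smooth_V1 (k : vanka_kind) m (D : 'I_m -> {set 'I_n1}) (q : nat)
    b x : 'cV[R]_(n1 + n2) :=
  col_mx
    (iter q
       (vanka_sweep k D (ulsubmx L) (usubmx b - ursubmx L *m dsubmx x))
       (usubmx x))
    (dsubmx x).

Definition smooth_V2 (M : 'M[R]_n2) (r : nat) b x : 'cV[R]_(n1 + n2) :=
  col_mx
    (usubmx x)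
    (iter r
       (dgs_sweep M (drsubmx L) (dsubmx b - dlsubmx L *m usubmx x))
       (dsubmx x)).

Definition combined_smoother (k : vanka_kind) m (D : 'I_m -> {set 'I_n1})
    (q : nat) (M : 'M[R]_n2) (r : nat) b x : 'cV[R]_(n1 + n2) :=
  smooth_V1 k D q b (smooth_V2 M r b (smooth_V1 k D q b x)).

End Smoother.

(* Main.v *)
(* A correction z + S (g - A z) followed by the one with matrix T is the    *)
(* correction with matrix S + T - T A S. For symmetric A, transposition     *)
(* reverses this composition, so a palindromic sequence of corrections, in  *)
(* which mirror-image steps have transposed matrices, is a correction with  *)
(* a symmetric matrix. Every sweep is such a palindrome, and a sweep on one *)
(* block is a correction of the whole system whose matrix is supported on   *)
(* that block.                                                              *)
From HB Require Import structures.
Require Import Defs.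
From mathcomp Require Import all_boot all_order all_algebra.
From mathcomp Require Import reals ring.

Import GRing.Theory.

Local Open Scope ring_scope.

(** A correction with matrix S started at 0 returns S b, so it suffices that n rounds of the
    smoother amount to one correction with a symmetric S independent of b and x;
    [symmetric_correction] records this. The property passes from f and h to the palindrome f h f
    ([symmetric_correction_conj]), to powers ([symmetric_correction_iter]), and from a diagonal
    block to L ([symmetric_correction_ublock], [symmetric_correction_dblock]). A single sweep has it
    because its matrix is symmetric or its two halves have mutually transposed matrices. *)

Definition symmetric_correction {R : realType} {n : nat} (A : 'M[R]_n)
    (f : 'cV[R]_n -> 'cV[R]_n -> 'cV[R]_n) : Prop :=
  exists2 S : 'M[R]_n, S^T = S & forall g z, f g z = correction A g S z.

(** The second step sees the residual u - A S u, where u is the initial one. *)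
Lemma correction_comp (R : realType) (n : nat) (A S T : 'M[R]_n) g z :
  correction A g T (correction A g S z) =
  correction A g (S + T - T *m A *m S) z.
Proof.
rewrite /correction; set u := g - A *m z.
have -> : g - A *m (z + S *m u) = u - A *m (S *m u).
  by rewrite mulmxDr opprD addrA.
by clearbody u; rewrite mulmxBr mulmxBl mulmxDl !mulmxA !addrA.
Qed.

Lemma symmetric_correction_transpose (R : realType) (n : nat)
    (A S : 'M[R]_n) :
  A^T = A ->
  symmetric_correction A
    (fun g z => correction A g S^T (correction A g S z)).
Proof.
move=> symA; exists (S + S^T - S^T *m A *m S).
  by rewrite !(linearB, linearD) /= !trmx_mul !trmxK symA mulmxA [S^T + S]addrC.
by move=> g z; rewrite correction_comp.
Qed.

Lemma symmetric_correction_conj (R : realType) (n : nat) (A : 'M[R]_n) f h :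
  A^T = A -> symmetric_correction A f -> symmetric_correction A h ->
  symmetric_correction A (fun g z => f g (h g (f g z))).
Proof.
move=> symA [S symS fE] [T symT hE].
set ST := S + T - T *m A *m S.
exists (ST + S - S *m A *m ST); last first.
  move=> g z; have -> : h g (f g z) = correction A g ST z.
    by rewrite fE hE correction_comp.
  by rewrite fE correction_comp.
have STt : ST^T = S + T - S *m A *m T.
  by rewrite !(linearB, linearD) /= !trmx_mul symA symS symT mulmxA.
rewrite [LHS](linearB, linearD) /= [(ST + S)^T]linearD /=.
rewrite !trmx_mul STt symA symS.
rewrite /ST !mulmxBr !mulmxBl !mulmxDl !mulmxDr !mulmxA !opprB !opprD.
(* Both sides are now 2S + T - SAS - SAT - TAS + SATAS; with the products generalized, the identity
   is linear and can be checked entrywise. *)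
move: (S *m A *m T *m A *m S) (S *m A *m T) (T *m A *m S) (S *m A *m S).
by move=> SATAS SAT TAS SAS; apply/matrixP=> i j; rewrite !mxE; ring.
Qed.

Lemma symmetric_correction_iter (R : realType) (n : nat) (A : 'M[R]_n) f k :
  A^T = A -> symmetric_correction A f ->
  symmetric_correction A (fun g z => iter k (f g) z).
Proof.
move=> symA [S symS fE].
(* The matrix of an iterate is a linear combination of S, SAS, SASAS, ..., hence T A S = S A T; the
   induction carries this identity because symmetry of the next matrix T + S - S A T rests on it. *)
suff [T [symT commT TE]] : exists T : 'M[R]_n, [/\ T^T = T,
    T *m A *m S = S *m A *m T
    & forall g z, iter k (f g) z = correction A g T z] by exists T.
elim: k => [|k [T [symT commT TE]]].
  exists 0; split=> [||g z]; rewrite ?trmx0 ?mulmx0 ?mul0mx //.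
  by rewrite /correction mul0mx addr0.
exists (T + S - S *m A *m T); split=> [||g z].
- by rewrite !(linearB, linearD) /= !trmx_mul symA symS symT mulmxA commT.
- rewrite !mulmxBl !mulmxDl mulmxBr mulmxDr commT.
  rewrite -!mulmxA ![A *m (_ *m _)]mulmxA !mulmxA.
  by rewrite -!(mulmxA (S *m A)) commT !mulmxA.
- by rewrite iterS TE fE correction_comp.
Qed.

HB.instance Definition _ (R : realType) (n : nat) :=
  Monoid.isLaw.Build 'M[R]_n 1%:M mulmx
    (@mulmxA R n n n n) (@mul1mx R n n) (@mulmx1 R n n).

(** Transposition reverses the factors and so cancels [rev_ord]. *)
Lemma trmx_prod_rev (R : realType) (n m : nat) (F : 'I_m -> 'M[R]_n) :
  (\big[mulmx/1%:M]_(i < m) F (rev_ord i))^T =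
  \big[mulmx/1%:M]_(i < m) (F i)^T.
Proof.
elim: m F => [|m IHm] F; first by rewrite !big_ord0 trmx1.
rewrite big_ord_recl big_ord_recr /= trmx_mul -IHm.
congr (_^T *m (F _)^T); last by apply: val_inj; rewrite /= subn1.
by apply: eq_bigr => i _; congr F; apply: val_inj; rewrite /= subSS.
Qed.

Lemma trmx_vanka_mx (R : realType) (n : nat) (A : 'M[R]_n) (D : {set 'I_n}) :
  A^T = A -> (vanka_mx A D)^T = vanka_mx A D.
Proof.
move=> symA; rewrite /vanka_mx !trmx_mul trmxK trmx_inv mulmxA.
by rewrite /local_mx !trmx_mul trmxK symA !mulmxA.
Qed.

Lemma trmx_additive_mx (R : realType) (n m : nat) (A : 'M[R]_n)
    (D : 'I_m -> {set 'I_n}) :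
  A^T = A -> (additive_mx D A)^T = additive_mx D A.
Proof.
move=> symA; rewrite /additive_mx linear_sum /=.
by apply: eq_bigr => i _; rewrite trmx_vanka_mx.
Qed.

(** The inverse of A moves through one factor at a time: both A^-1 (I - A K) and (I - K A) A^-1
    equal A^-1 - K. *)
Lemma mul_invmx_prod (R : realType) (n m : nat) (A : 'M[R]_n)
    (K : 'I_m -> 'M[R]_n) :
  A \in unitmx ->
  invmx A *m \big[mulmx/1%:M]_(i < m) (1%:M - A *m K i) =
  \big[mulmx/1%:M]_(i < m) (1%:M - K i *m A) *m invmx A.
Proof.
move=> uA; elim: m K => [|m IHm] K; first by rewrite !big_ord0 mulmx1 mul1mx.
rewrite !big_ord_recl /= mulmxA -mulmxA -[in RHS]mulmxA -IHm !mulmxA.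
by congr (_ *m _); rewrite mulmxBr mulmxBl mulmx1 mul1mx mulKmx // mulmxK.
Qed.

Lemma trmx_forward_mx (R : realType) (n m : nat) (A : 'M[R]_n)
    (D : 'I_m -> {set 'I_n}) :
  A^T = A -> A \in unitmx -> (forward_mx D A)^T = backward_mx D A.
Proof.
move=> symA uA; rewrite /forward_mx /backward_mx trmx_mul trmx_inv symA.
rewrite linearB /= trmx1.
rewrite (trmx_prod_rev _ _ _ (fun i => 1%:M - vanka_mx A (D i) *m A)).
rewrite mulmxBr mulmxBl mulmx1 mul1mx -mul_invmx_prod //.
congr (_ - _ *m _); apply: eq_bigr => i _.
by rewrite linearB /= trmx1 trmx_mul symA trmx_vanka_mx.
Qed.

Lemma symmetric_correction_vanka (R : realType) (n m : nat) (A : 'M[R]_n)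
    (k : vanka_kind) (D : 'I_m -> {set 'I_n}) :
  A^T = A -> vanka_admissible k D A ->
  symmetric_correction A (vanka_sweep k D A).
Proof.
case: k => symA [_ uA].
  by exists (additive_mx D A); first exact: trmx_additive_mx.
rewrite /vanka_sweep -trmx_forward_mx ?uA //.
exact: symmetric_correction_transpose.
Qed.

Lemma symmetric_correction_dgs (R : realType) (n : nat) (A M : 'M[R]_n) :
  A^T = A -> symmetric_correction A (dgs_sweep M A).
Proof.
move=> symA; rewrite /dgs_sweep -trmx_mul.
exact: symmetric_correction_transpose.
Qed.

(** With x2 frozen on the right-hand side, the local residual is exactly the upper block of b - L x,
    so S padded with zeros acts on the whole system. *)
Lemma symmetric_correction_ublock (R : realType) (n1 n2 : nat)
    (L : 'M[R]_(n1 + n2)) f :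
  symmetric_correction (ulsubmx L) f ->
  symmetric_correction L (fun b x =>
    col_mx (f (usubmx b - ursubmx L *m dsubmx x) (usubmx x)) (dsubmx x)).
Proof.
case=> S symS fE; exists (block_mx S 0 0 0).
  by rewrite tr_block_mx !trmx0 symS.
move=> b x; rewrite fE -[in RHS](vsubmxK b) -[in RHS](vsubmxK x).
rewrite -[in RHS](submxK L) /correction mul_block_col opp_col_mx.
rewrite add_col_mx mul_block_col.
by rewrite !mul0mx !addr0 add_col_mx addr0 opprD addrAC addrA.
Qed.

Lemma symmetric_correction_dblock (R : realType) (n1 n2 : nat)
    (L : 'M[R]_(n1 + n2)) f :
  symmetric_correction (drsubmx L) f ->
  symmetric_correction L (fun b x =>
    col_mx (usubmx x) (f (dsubmx b - dlsubmx L *m usubmx x) (dsubmx x))).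
Proof.
case=> S symS fE; exists (block_mx 0 0 0 S).
  by rewrite tr_block_mx !trmx0 symS.
move=> b x; rewrite fE -[in RHS](vsubmxK b) -[in RHS](vsubmxK x).
rewrite -[in RHS](submxK L) /correction mul_block_col opp_col_mx.
rewrite add_col_mx mul_block_col.
by rewrite !mul0mx !add0r add_col_mx addr0 opprD addrA.
Qed.

Theorem theorem4 (R : realType) (n1 n2 : nat) (L : 'M[R]_(n1 + n2))
    (k : vanka_kind) (m : nat) (D : 'I_m -> {set 'I_n1}) (q : nat)
    (M : 'M[R]_n2) (r : nat) :
  L^T = L ->
  vanka_admissible k D (ulsubmx L) ->
  dgs_admissible M (drsubmx L) ->
  (1 <= q)%N -> (1 <= r)%N ->
  forall n : nat, (1 <= n)%N ->
  exists C : 'M[R]_(n1 + n2),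
    C^T = C /\
    forall b : 'cV[R]_(n1 + n2),
      iter n (combined_smoother L k D q M r b) 0 = C *m b.
Proof.
move=> symL admV _ _ _ n _.
have symL11 : (ulsubmx L)^T = ulsubmx L by rewrite trmx_ulsub symL.
have symL22 : (drsubmx L)^T = drsubmx L by rewrite trmx_drsub symL.
have V1 : symmetric_correction L (smooth_V1 L k D q).
  apply: (symmetric_correction_ublock _ _ _ _ (fun g => iter q _)).
  apply: symmetric_correction_iter => //; exact: symmetric_correction_vanka.
have V2 : symmetric_correction L (smooth_V2 L M r).
  apply: (symmetric_correction_dblock _ _ _ _ (fun g => iter r _)).
  apply: symmetric_correction_iter => //; exact: symmetric_correction_dgs.
have [C symC CE] := symmetric_correction_iter _ _ _ _ n symL
  (symmetric_correction_conj _ _ _ _ _ symL V1 V2).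
(* At the zero start the residual is b itself. *)
by exists C; split=> // b; rewrite CE /correction mulmx0 subr0 add0r.
Qed.
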